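(* For all positive integers $t,n$, $$R_{<}(P_n^t,P_n^t) \leq (400t^3)^{t^2}\,n^{4t-2}.$$
   Context: An ordered graph is a graph whose vertices have a fixed linear ordering. For ordered graphs $G,H$, the ordered Ramsey number $R_{<}(G,H)$ is the minimum $N$ such that every red/blue edge-coloring of the complete graph on $\{1,\dots,N\}$ contains a red copy of $G$ or a blue copy of $H$ whose vertices appear in the correct order (i.e. the embedding into $\{1,\dots,N\}$ is order-preserving). $P_n^t$ is the $t$-th power of the monotone path on $n$ vertices: the ordered graph with vertices $1,\dots,n$ and edge set $\{(i,j) : i < j \leq i+t\}$. *)

(* Defs.v *)
From HB Require Import structures.
From mathcomp Require Import all_boot.
Set Implicit Arguments.
Unset Strict Implicit.
Unset Printing Implicit Defensive.

(* A finite graph with linearly ordered vertices, taken up to the unique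
   order isomorphism of its vertex set with {0 < ... < n-1}. *)
Record ordered_graph := OrderedGraph {
  gsize : nat;
  edge : rel 'I_gsize;
  edge_sym : symmetric edge;
  edge_irr : irreflexive edge }.

(* An edge coloring of the complete graph on 'I_N: an edge is a 2-element set,
   and the values on other subsets are never used. true is red, false blue. *)
Definition coloring (N : nat) := {ffun {set 'I_N} -> bool}.

(* Copies are subgraphs, not necessarily induced ones. *)
Definition ordered_copy (N : nat) (c : coloring N) (col : bool)
    (G : ordered_graph) : bool :=
  [exists f : {ffun 'I_(gsize G) -> 'I_N},
    [forall i : 'I_(gsize G), forall j : 'I_(gsize G), (i < j) ==> (f i < f j)] &&
    [forall i, forall j, edge i j ==> (c [set f i; f j] == col)]].

Definition ramsey_arrow (G H : ordered_graph) (N : nat) : bool :=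
  [forall c : coloring N, ordered_copy c true G || ordered_copy c false H].

Lemma ramsey_seq (a b : nat) : exists N, forall (T : eqType) (c : rel T)
    (s : seq T), N <= size s ->
  exists2 s', subseq s' s &
    (size s' == a) && pairwise c s' ||
    (size s' == b) && pairwise (fun x y => ~~ c x y) s'.
Proof.
elim: a b => [|a IHa] b; first by exists 0 => T c s _; exists [::]; rewrite ?sub0seq.
elim: b => [|b [N2 IH2]].
  by exists 0 => T c s _; exists [::]; rewrite ?sub0seq ?orbT.
have [N1 IH1] := IHa b.+1.
exists (N1 + N2).+1 => T c [//|x s] /=; rewrite ltnS => les.
have [le1|lt1] := leqP N1 (size (filter (c x) s)).
  have [s' sub' /orP[]/andP[/eqP sz pw]] := IH1 T c _ le1.
    exists (x :: s'); first by rewrite /= eqxx (subseq_trans sub') ?filter_subseq.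
    rewrite /= sz eqxx pw andbT /=; apply/orP; left.
    by apply/allP => y /(mem_subseq sub'); rewrite mem_filter => /andP[].
  exists s'; last by rewrite sz eqxx pw orbT.
  exact: subseq_trans sub' (subseq_trans (filter_subseq _ _) (subseq_cons _ _)).
have le2 : N2 <= size (filter (predC (c x)) s).
  rewrite -(leq_add2l N1); apply: (leq_trans les).
  by rewrite -(count_predC (c x) s) -!size_filter leq_add2r ltnW.
have [s' sub' /orP[]/andP[/eqP sz pw]] := IH2 T c _ le2.
  exists s'; last by rewrite sz eqxx pw.
  exact: subseq_trans sub' (subseq_trans (filter_subseq _ _) (subseq_cons _ _)).
exists (x :: s'); first by rewrite /= eqxx (subseq_trans sub') ?filter_subseq.
rewrite /= sz eqxx pw andbT /=; apply/orP; right.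
by apply/allP => y /(mem_subseq sub'); rewrite mem_filter => /andP[].
Qed.

Lemma ordered_copy_clique (N : nat) (c : coloring N) (col : bool)
    (G : ordered_graph) (s : seq 'I_N) :
  subseq s (enum 'I_N) -> size s = gsize G ->
  pairwise (fun x y => c [set x; y] == col) s -> ordered_copy c col G.
Proof.
move=> sub sz pw.
have lts : pairwise (fun x y : 'I_N => x < y) s.
  apply: subseq_pairwise sub _.
  have: sorted ltn (map val (enum 'I_N)) by rewrite val_enum_ord iota_ltn_sorted.
  by rewrite sorted_pairwise ?pairwise_map //; apply: ltn_trans.
pose f := [ffun i : 'I_(gsize G) => tnth (Tuple (introT eqP sz)) i].
have fE x0 i : f i = nth x0 s i by rewrite ffunE (tnth_nth x0).
have key (i j : 'I_(gsize G)) : i < j -> (f i < f j) && (c [set f i; f j] == col).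
  move=> ltij; set x0 := f i; rewrite /x0 (fE x0 i) (fE x0 j).
  have iin : (i : nat) \in gtn (size s) by rewrite inE sz.
  have jin : (j : nat) \in gtn (size s) by rewrite inE sz.
  apply/andP; split.
    by move/(pairwiseP x0): lts => /(_ i j iin jin ltij).
  by move/(pairwiseP x0): pw => /(_ i j iin jin ltij).
apply/existsP; exists f; apply/andP; split; apply/forallP=> i; apply/forallP=> j.
  by apply/implyP=> /key/andP[].
apply/implyP=> eij; case: (ltngtP i j) => [/key/andP[]//|/key/andP[_]|/val_inj ij].
  by rewrite setUC.
by rewrite ij edge_irr in eij.
Qed.

Lemma ramsey_arrow_exists (G H : ordered_graph) :
  exists N, ramsey_arrow G H N.
Proof.
have [N ramN] := ramsey_seq (gsize G) (gsize H).
exists N; apply/forallP => c.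
have [|s sub /orP[]/andP[/eqP sz pw]] :=
  ramN _ (fun x y => c [set x; y]) (enum 'I_N); first by rewrite size_enum_ord.
  apply/orP; left; apply: ordered_copy_clique sub sz _.
  by apply: sub_pairwise pw => x y /= ->.
apply/orP; right; apply: ordered_copy_clique sub sz _.
by apply: sub_pairwise pw => x y /= /negbTE ->.
Qed.

Definition ordered_ramsey (G H : ordered_graph) : nat :=
  ex_minn (ramsey_arrow_exists G H).

Definition path_power_edge (n t : nat) : rel 'I_n :=
  fun i j => (i < j <= i + t) || (j < i <= j + t).

Lemma path_power_sym (n t : nat) : symmetric (@path_power_edge n t).
Proof. by move=> i j; rewrite /path_power_edge orbC. Qed.

Lemma path_power_irr (n t : nat) : irreflexive (@path_power_edge n t).
Proof. by move=> i; rewrite /path_power_edge ltnn. Qed.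

Definition path_power (n t : nat) : ordered_graph :=
  OrderedGraph (@path_power_sym n t) (@path_power_irr n t).

(* Main.v *)
Require Import Defs.
From mathcomp Require Import all_boot.
From mathcomp Require Import zify.

Set Implicit Arguments.
Unset Strict Implicit.
Unset Printing Implicit Defensive.

(* A chain of l red t-cliques M_1 < ... < M_l with consecutive cliques
   completely joined in red contains the red t-th power of a path on l t
   vertices.  Say that a set Y has level l if it lies after such a chain and is
   completely joined in red to M_l.  If no red power on n vertices exists,
   levels are smaller than n, so every one of n^2 consecutive long intervals
   contains a large set D that is a disjoint union of y-sets of some level
   l < n but contains no y-set of level l + 1, and n of these sets,
   D_1 < ... < D_n, share the same l.
   Let b < c.  If a y-set Y of level l in D_b had many vertices of red degree at
   least |D_c| / q into D_c, then, as large sets without a blue n-clique contain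
   red t-cliques, double counting over t-tuples of D_c would give a red t-clique
   M in Y with y common red neighbors in D_c; these would form a y-set of level
   l + 1.  Hence almost all pairs between D_b and D_c are blue, and a blue power
   is found greedily with one vertex in each D_b.  For t > 1 this gives
   O(n^(2 t + 1)) <= O(n^(4 t - 2)); the case t = 1 is the Erdos-Szekeres
   argument. *)

(** * Finite sets, cliques and common neighborhoods *)

Lemma bin_leq_exp (m k : nat) : 'C(m, k) <= m ^ k.
Proof.
apply: (@leq_trans (m ^_ k)); first by rewrite -bin_ffact leq_pmulr ?fact_gt0.
elim: k => [|k IHk]; first by rewrite ffactn0.
by rewrite ffactnSr expnSr leq_mul ?leq_subr.
Qed.

Lemma subset_of_card (T : finType) (A : {set T}) (k : nat) :
  k <= #|A| -> exists2 B : {set T}, B \subset A & #|B| = k.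
Proof.
move=> lek; exists [set x in take k (enum A)].
  by apply/subsetP => x; rewrite inE => /mem_take; rewrite mem_enum.
rewrite cardsE; have /card_uniqP -> : uniq (take k (enum A)).
  exact/take_uniq/enum_uniq.
by rewrite size_takel // -cardE.
Qed.

Definition clique (T : finType) (e : rel T) (A : {set T}) : bool :=
  [forall u in A, forall v in A, (u != v) ==> e u v].

Lemma cliqueP (T : finType) (e : rel T) (A : {set T}) :
  reflect {in A &, forall u v, u != v -> e u v} (clique e A).
Proof.
apply: (iffP forall_inP) => [H u v uA vA uv|H u uA].
  by have /forall_inP/(_ v vA) := H u uA; rewrite uv.
by apply/forall_inP => v vA; apply/implyP; apply: H.
Qed.

Lemma clique1U (T : finType) (e : rel T) (x : T) (A : {set T}) :
  symmetric e -> clique e A -> {in A, forall u, e x u} -> clique e (x |: A).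
Proof.
move=> symE /cliqueP clA exA; apply/cliqueP => u v.
case/setU1P=> [->|uA] /setU1P[->|vA] uv; rewrite ?eqxx // in uv *.
- exact: exA.
- by rewrite symE exA.
- exact: clA.
Qed.

(** Read [e] as red and its negation as blue. A vertex with at least [m ^ k] red neighbors allows
    induction on [k]. Otherwise picking a vertex and discarding its red neighbors costs at most
    [m ^ k] vertices, and [m] such picks form a blue clique. *)
Lemma ramsey_clique (T : finType) (e : rel T) (m k : nat) (S : {set T}) :
  symmetric e -> 0 < m -> m ^ k <= #|S| ->
  (exists M : {set T}, [/\ M \subset S, #|M| = k.+1 & clique e M]) \/
  (exists M : {set T},
     [/\ M \subset S, #|M| = m & clique (fun u v => ~~ e u v) M]).
Proof.
move=> symE m_gt0; elim: k S => [|k IHk] S leS.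
  left; have [M sMS cM] := subset_of_card leS; exists M; split=> //.
  apply/cliqueP => u v uM vM; move/eqP: cM => /cards1P[x defM].
  by move: uM vM; rewrite defM !inE => /eqP-> /eqP->; rewrite eqxx.
suff: forall j (S' : {set T}), S' \subset S -> j * m ^ k <= #|S'| ->
    (exists M : {set T}, [/\ M \subset S, #|M| = k.+2 & clique e M]) \/
    (exists M : {set T},
       [/\ M \subset S, #|M| = m & clique (fun u v => ~~ e u v) M]) \/
    (exists M : {set T},
       [/\ M \subset S', #|M| = j & clique (fun u v => ~~ e u v) M]).
  case/(_ m S (subxx _)); rewrite -?expnS //; first by left.
  by case; right.
elim=> [|j IHj] S' sS'S leS'.
  right; right; exists set0; rewrite sub0set cards0; split=> //.
  by apply/cliqueP => u v; rewrite inE.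
have [x xS'] : exists x, x \in S'.
  apply/set0Pn; rewrite -card_gt0; apply: leq_trans leS'.
  by rewrite muln_gt0 expn_gt0 m_gt0.
pose R := [set y in S' | (y != x) && e x y].
have sRS : R \subset S' by apply/subsetP => y; rewrite inE => /andP[].
have [leR|ltR] := leqP (m ^ k) #|R|.
  case: (IHk R leR) => -[M [sMR cM clM]].
    left; exists (x |: M); split.
    - rewrite subUset sub1set (subsetP sS'S) //.
      by rewrite (subset_trans sMR) // (subset_trans sRS).
    - rewrite cardsU1 cM; case: (boolP (x \in M)) => // /(subsetP sMR).
      by rewrite inE eqxx andbF.
    - by apply: clique1U => // u /(subsetP sMR); rewrite inE => /and3P[].
  right; left; exists M; split=> //.
  by rewrite (subset_trans sMR) // (subset_trans sRS).
pose S'' := S' :\: (x |: R).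
have sS'' : S'' \subset S' by rewrite subsetDl.
case: (IHj S'' (subset_trans sS'' sS'S)).
- have sub : x |: R \subset S' by rewrite subUset sub1set xS'.
  rewrite cardsD (setIidPr sub).
  have : #|x |: R| <= m ^ k by rewrite cardsU1; case: (_ \notin _); lia.
  by move: leS'; rewrite mulSn; lia.
- by left.
case=> [|[M [sMS cM clM]]]; first by right; left.
right; right; exists (x |: M); split.
- by rewrite subUset sub1set xS' (subset_trans sMS).
- rewrite cardsU1 cM; case: (boolP (x \in M)) => // /(subsetP sMS).
  by rewrite !inE eqxx.
- apply: clique1U => // [u v|u /(subsetP sMS)]; first by rewrite symE.
  rewrite !inE negb_or negb_and => /andP[/andP[ux /orP[|]]].
    by case: (u \in S').
  by rewrite ux.
Qed.

(* A [t]-tuple of [D] with [r] common neighbors in [Y] selects some [M].  As [M]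
   is selected by at most (codegree of [M])^[t] tuples and there are at most
   [#|Y| ^ t] sets [M], taking [t]-th roots loses only a factor [#|Y|]. *)
Lemma common_neighborhood (T : finType) (e : rel T) (P : pred {set T})
    (Y D : {set T}) (t q r y : nat) :
  0 < t -> 0 < q -> 0 < r ->
  (forall S : {set T}, S \subset Y -> r <= #|S| ->
     exists M : {set T}, [/\ M \subset S, #|M| = t & P M]) ->
  {in Y, forall v, #|D| <= q * #|[set d in D | e v d]|} ->
  2 * r * q ^ t <= #|Y| -> 2 * q * #|Y| * y <= #|D| ->
  exists M : {set T}, [/\ M \subset Y, #|M| = t, P M &
    y <= #|[set d in D | [forall u in M, e u d]]|].
Proof.
move=> t_gt0 q_gt0 r_gt0 exM degY leY leD.
have qt_gt0 : 0 < q ^ t by rewrite expn_gt0 q_gt0.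
have Y_gt0 : 0 < #|Y| by apply: leq_trans leY; rewrite !muln_gt0 r_gt0.
pose nb (M : {set T}) := [set d in D | [forall u in M, e u d]].
pose K := [set M : {set T} | [&& M \subset Y, #|M| == t & P M]].
case: (boolP [exists M in K, y <= #|nb M|]) => [|noM].
  case/exists_inP => M; rewrite inE => /and3P[sMY /eqP cM PM] leM.
  by exists M.
exfalso.
have y_gt0 : 0 < y.
  case: (posnP y) noM => // -> /exists_inP[].
  have [|M [sM cM PM]] := exM Y (subxx _).
    by apply: leq_trans leY; rewrite -mulnA mulnCA leq_pmulr // muln_gt0.
  by exists M; rewrite // inE sM cM eqxx.
have ltK M : M \in K -> #|nb M| <= y.-1.
  move=> MK; move: noM; rewrite negb_exists_in => /forall_inP/(_ _ MK).
  by rewrite -ltnNge; case: (y) y_gt0.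
pose F := [set g : {ffun 'I_t -> T} | g \in ffun_on (mem D)].
have cF : #|F| = #|D| ^ t by rewrite cardsE card_ffun_on card_ord.
pose S (g : {ffun 'I_t -> T}) := [set v in Y | [forall i, e v (g i)]].
pose big := [set g in F | r <= #|S g|].
(* Count pairs of a tuple and a common neighbor in [Y]: each [v] in [Y] is joined to all entries of
   at least [(#|D| / q) ^ t] tuples. *)
have sumS : #|Y| * #|D| ^ t <= q ^ t * \sum_(g in F) #|S g|.
  have -> : \sum_(g in F) #|S g| =
      \sum_(v in Y) #|[set d in D | e v d]| ^ t.
    transitivity (\sum_(g in F) \sum_(v in Y) [forall i, e v (g i)] : nat).
      apply: eq_bigr => g _; rewrite -sum1_card big_mkcond [RHS]big_mkcond /=.
      by apply: eq_bigr => v _; rewrite inE; case: (v \in Y); case: [forall _, _].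
    rewrite exchange_big; apply: eq_bigr => v vY /=.
    rewrite -[X in _ ^ X](card_ord t) -card_ffun_on -sum1_card big_mkcond.
    rewrite [RHS]big_mkcond; apply: eq_bigr => g _; rewrite inE.
    case: (boolP (g \in ffun_on _)) => [/ffun_onP gD|gD].
      congr (nat_of_bool _); apply/forallP/ffun_onP => H i; last first.
        by have := H i; rewrite !inE => /andP[].
      by rewrite !inE H andbT; apply: gD.
    case: ffun_onP => // H; case/ffun_onP: gD => i.
    by have := H i; rewrite !inE => /andP[].
  rewrite -sum_nat_const big_distrr /=; apply: leq_sum => v vY.
  by rewrite -expnMn leq_exp2r ?degY.
have sumS' : \sum_(g in F) #|S g| <= r * #|D| ^ t + #|Y| * #|big|.
  rewrite -cF -[X in _ * X + _]sum1_card -[X in _ + _ * X]sum1_card.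
  rewrite !big_distrr /=.
  rewrite [X in _ <= _ + X](_ : _ = \sum_(g in F) #|Y| * (r <= #|S g|)).
    rewrite -big_split /=; apply: leq_sum => g _.
    case: (leqP r #|S g|) => [_|/ltnW]; last first.
      by rewrite /= muln1 muln0 addn0.
    rewrite /= !muln1 addnC; apply: leq_trans (leq_addr _ _); apply: subset_leq_card.
    by apply/subsetP => v; rewrite inE => /andP[].
  rewrite big_mkcond [RHS]big_mkcond /=; apply: eq_bigr => g _.
  by rewrite [g \in big]inE; case: (g \in F) => //=; case: (r <= _); rewrite ?muln0.
have le_big : #|big| <= #|Y| ^ t * y.-1 ^ t.
  apply: (@leq_trans (\sum_(M in K) #|nb M| ^ t)).
    apply: (@leq_trans (\sum_(g in big) \sum_(M in K) (g \in ffun_on (mem (nb M))))).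
      rewrite -sum1_card; apply: leq_sum => g; rewrite inE => /andP[gF leS].
      have [|M [sM cM PM]] := exM (S g) _ leS.
        by apply/subsetP => v; rewrite inE => /andP[].
      have MK : M \in K.
        rewrite inE cM eqxx PM (subset_trans sM) //.
        by apply/subsetP => v; rewrite inE => /andP[].
      rewrite (bigD1 M) //= (_ : _ \in _) //.
      apply/ffun_onP => i; rewrite !inE; apply/andP; split.
        by move: gF; rewrite inE => /ffun_onP/(_ i).
      apply/forall_inP => u /(subsetP sM); rewrite inE => /andP[_].
      by move/forallP.
    rewrite exchange_big; apply: leq_sum => M _ /=.
    rewrite -[X in _ ^ X](card_ord t) -card_ffun_on -sum1_card.
    rewrite big_mkcond [X in _ <= X]big_mkcond /=; apply: leq_sum => g _.
    by case: (g \in big) => //; case: (g \in ffun_on _).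
  apply: (@leq_trans (#|K| * y.-1 ^ t)).
    rewrite -sum_nat_const; apply: leq_sum => M /ltK leM.
    by rewrite leq_exp2r.
  rewrite leq_mul2r; apply/orP; right; apply: leq_trans (bin_leq_exp _ _).
  rewrite -cards_draws; apply: subset_leq_card; apply/subsetP => M.
  by rewrite !inE => /and3P[-> ->].
(* As [2 * r * q ^ t <= #|Y|], tuples outside [big] account for at most half of the pairs. *)
have half : #|D| ^ t <= 2 * q ^ t * #|big|.
  rewrite -(leq_pmul2l Y_gt0).
  have h1 : #|Y| * #|D| ^ t <= q ^ t * (r * #|D| ^ t + #|Y| * #|big|).
    by apply: leq_trans sumS _; rewrite leq_mul2l sumS' orbT.
  have h2 : 2 * r * q ^ t * #|D| ^ t <= #|Y| * #|D| ^ t.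
    by rewrite leq_mul2r leY orbT.
  move: h1 h2; rewrite mulnDr; nia.
have lt_y : y.-1 ^ t < y ^ t by rewrite ltn_exp2r // prednK.
(* Contradiction: [2 ^ t] on the left absorbs the [2] on the right, and [y.-1 ^ t < y ^ t] is
   strict. *)
have : (2 * q * #|Y| * y) ^ t <= 2 * q ^ t * (#|Y| ^ t * y.-1 ^ t).
  apply: (@leq_trans (#|D| ^ t)); first by rewrite leq_exp2r.
  by apply: leq_trans half _; rewrite leq_mul2l le_big orbT.
apply/negP; rewrite -ltnNge !expnMn.
apply: (@leq_trans (2 * q ^ t * (#|Y| ^ t * y ^ t))).
  by rewrite ltn_pmul2l ?muln_gt0 // ltn_pmul2l // expn_gt0 Y_gt0.
rewrite mulnA leq_mul // leq_mul // leq_mul //.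
by rewrite -{1}(expn1 2) leq_exp2l.
Qed.

(** * Extraction of sets of an exact level *)

(** Remove [y]-sets satisfying [P] until fewer than [k] vertices remain. Each removed set meets [Q]
    in at most [a] of its [y] vertices, and these bounds add up over disjoint sets. *)
Lemma disjoint_extraction (T : finType) (P : pred {set T}) (y k : nat)
    (S : {set T}) :
  0 < y ->
  (forall X : {set T}, X \subset S -> k <= #|X| ->
     exists Y : {set T}, [/\ Y \subset X, #|Y| = y & P Y]) ->
  exists D : {set T}, [/\ D \subset S, #|S| < #|D| + k.+1 &
    forall (Q : {set T}) (a : nat),
      (forall Y : {set T}, Y \subset D -> #|Y| = y -> P Y ->
         #|Y :&: Q| <= a) ->
      #|D :&: Q| * y <= a * #|D|].
Proof.
move=> y_gt0; have [j] := ubnP #|S|.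
elim: j S => // j IHj S ltSj exY.
have [leS|ltS] := leqP k #|S|; last first.
  exists set0; rewrite sub0set cards0; split=> //; first by rewrite ltnW.
  by move=> Q a _; rewrite set0I cards0.
have [Y [sYS cY PY]] := exY S (subxx _) leS.
have cSY : #|S :\: Y| + y = #|S|.
  by rewrite -cY -(cardsID Y S) (setIidPr sYS) addnC.
case: (IHj (S :\: Y)).
- by move: ltSj cSY; lia.
- by move=> X sX; apply: exY; apply: subset_trans sX (subsetDl _ _).
move=> D [sD ltD denseD].
have dis (Z : {set T}) : #|(Y :|: D) :&: Z| = #|Y :&: Z| + #|D :&: Z|.
  rewrite setIUl cardsU (_ : (Y :&: Z) :&: (D :&: Z) = set0) ?cards0 ?subn0 //.
  apply/setP => x; rewrite !inE; apply/negP => /andP[/andP[xY _] /andP[/(subsetP sD)]].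
  by rewrite inE xY.
have cYD : #|Y :|: D| = y + #|D| by have := dis setT; rewrite !setIT cY.
exists (Y :|: D); split.
- by rewrite subUset sYS (subset_trans sD) ?subsetDl.
- by rewrite cYD; move: ltD cSY; lia.
move=> Q a leQ; rewrite dis cYD mulnDl mulnDr leq_add //.
  by rewrite leq_mul2r leQ ?orbT // subsetUl.
by apply: denseD => Z sZ; apply: leQ; apply: subset_trans sZ (subsetUr _ _).
Qed.

(* [D] is a disjoint union of [y]-sets of level [l]; this is only recorded
   through its effect on counting: [Q] is no denser in [D] than in these sets. *)
Lemma exact_level (T : finType) (P : nat -> pred {set T}) (n y w : nat)
    (S : {set T}) :
  0 < y -> (forall Y : {set T}, P 0 Y) -> (forall Y : {set T}, ~~ P n Y) ->
  y + n * w <= #|S| ->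
  exists l (D : {set T}), [/\ l < n, D \subset S, w <= #|D|,
    forall Y : {set T}, Y \subset D -> #|Y| = y -> ~~ P l.+1 Y &
    forall (Q : {set T}) (a : nat),
      (forall Y : {set T}, Y \subset D -> #|Y| = y -> P l Y ->
         #|Y :&: Q| <= a) ->
      #|D :&: Q| * y <= a * #|D|].
Proof.
move=> y_gt0 P0 Pn leS.
pose full l := [forall (X : {set T} | (X \subset S) && (y + l * w <= #|X|)),
  exists Y : {set T}, [&& Y \subset X, #|Y| == y & P l Y]].
have full0 : full 0.
  apply/forall_inP => X /andP[_]; rewrite addn0 => /subset_of_card[Y sY cY].
  by apply/existsP; exists Y; rewrite sY cY eqxx P0.
have fulln : ~~ full n.
  apply/negP => /forall_inP/(_ S); rewrite subxx leS => /(_ isT)/existsP[Y].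
  by rewrite (negbTE (Pn Y)) !andbF.
have [l [ltln fl nfl]] : exists l, [/\ l < n, full l & ~~ full l.+1].
  elim: (n) fulln => [|m IHm] fm; first by rewrite full0 in fm.
  case: (boolP (full m)) => [fm'|/IHm[l [ltlm fl fl1]]]; first by exists m.
  by exists l; split=> //; rewrite ltnW.
case/forall_inPn: nfl => X /andP[sX leX] noY.
(* [X] has at least [y + l.+1 * w] vertices, and extraction at level [l] leaves at most [y + l * w]
   of them, hence [w <= #|D|]. *)
case: (@disjoint_extraction T (P l) y (y + l * w) X) => //.
  move=> Z sZ leZ; have /forall_inP/(_ Z) := fl.
  rewrite leZ (subset_trans sZ) // => /(_ isT)/existsP[Y /and3P[sY /eqP cY PY]].
  by exists Y.
move=> D [sD ltD denseD]; exists l, D; split=> //.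
- exact: subset_trans sD sX.
- by move: leX ltD; rewrite mulSn; lia.
- move=> Y sY cY; apply: contra noY => PY; apply/existsP; exists Y.
  by rewrite (subset_trans sY) // cY eqxx.
Qed.

Lemma pigeonhole_fiber (T R : finType) (f : T -> R) (k : nat) :
  0 < #|T| -> #|R| * k <= #|T| -> exists r : R, k <= #|[set x | f x == r]|.
Proof.
move=> T_gt0 le_kT; apply/existsP; apply: contraLR le_kT.
rewrite negb_exists -ltnNge => /forallP lt_k.
have sumT : #|T| = \sum_r #|[set x | f x == r]|.
  rewrite -sum1_card (partition_big f xpredT) //=; apply: eq_bigr => r _.
  by rewrite -sum1_card; apply: eq_bigl => x; rewrite inE.
have k_gt0 : 0 < k.
  have /card_gt0P[x _] := T_gt0.
  by apply: (@leq_ltn_trans #|[set z | f z == f x]|); rewrite // ltnNge.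
have le1 r : #|[set x | f x == r]| <= k.-1.
  by have := lt_k r; case: (k) k_gt0 => // k' _; rewrite -ltnNge.
apply: (@leq_ltn_trans (#|R| * k.-1)).
  by rewrite sumT -sum_nat_const; apply: leq_sum => r _.
rewrite ltn_mul2l prednK // leqnn andbT.
by have /card_gt0P[x _] := T_gt0; apply/card_gt0P; exists (f x).
Qed.

(** * Power paths as sequences and chains of red cliques *)

(** The default [x0] is quantified because ['I_N] may be empty; both indices are in range, so [nth]
    never returns it. *)
Definition power_path (N : nat) (e : rel 'I_N) (t : nat) (s : seq 'I_N) :=
  forall x0 i j, i < j -> j < size s ->
    nth x0 s i < nth x0 s j /\ (j <= i + t -> e (nth x0 s i) (nth x0 s j)).

Lemma power_path_copy (N : nat) (c : coloring N) (col : bool) (t n : nat)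
    (s : seq 'I_N) :
  n <= size s -> power_path (fun u v => c [set u; v] == col) t s ->
  ordered_copy c col (path_power n t).
Proof.
case: n => [|n] les pps.
  by apply/existsP; exists [ffun i : 'I_0 => widen_ord (leq0n N) i];
    apply/andP; split; apply/forallP; case.
have x0 : 'I_N by case: (s) les.
pose f := [ffun i : 'I_n.+1 => nth x0 s i].
have ltsz (i : 'I_n.+1) : i < size s by apply: leq_trans les.
apply/existsP; exists f; apply/andP.
split; apply/forallP => i; apply/forallP => j; apply/implyP; rewrite !ffunE.
  by move=> ltij; have [] := pps x0 i j ltij (ltsz j).
case/orP => /andP[ltij leij].
  by have [_ ->] := pps x0 i j ltij (ltsz j).
by rewrite setUC; have [_ ->] := pps x0 j i ltij (ltsz i).
Qed.

Lemma ltn_ord_enum (N : nat) (A : {set 'I_N}) :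
  pairwise (fun u v : 'I_N => u < v) (enum A).
Proof.
rewrite {1}/enum_mem -enumT; apply: subseq_pairwise (filter_subseq _ _) _.
have: sorted ltn (map val (enum 'I_N)) by rewrite val_enum_ord iota_ltn_sorted.
by rewrite sorted_pairwise ?pairwise_map //; apply: ltn_trans.
Qed.

Lemma nth_enum_lt (N : nat) (A : {set 'I_N}) x0 i j :
  i < j -> j < #|A| -> nth x0 (enum A) i < nth x0 (enum A) j.
Proof.
rewrite cardE => ltij ltj; have /pairwiseP := ltn_ord_enum A.
by apply=> //; rewrite inE // (ltn_trans ltij).
Qed.

Lemma clique_power_path (N : nat) (e : rel 'I_N) (t : nat) (M : {set 'I_N}) :
  clique e M -> power_path e t (enum M).
Proof.
move=> /cliqueP clM x0 i j ltij; rewrite -cardE => ltj.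
have lt := nth_enum_lt x0 ltij ltj; split=> // _; apply: clM.
- by rewrite -mem_enum mem_nth // -cardE (ltn_trans ltij).
- by rewrite -mem_enum mem_nth // -cardE.
- by apply: contraTneq lt => ->; rewrite ltnn.
Qed.

(* [Y] lies after, and is completely joined to the end of, a chain of [l]
   cliques of size [t] with consecutive cliques completely joined. *)
Fixpoint chain_end (N : nat) (e : rel 'I_N) (t l : nat) (Y : {set 'I_N}) : bool :=
  if l is l'.+1 then
    [exists X : {set 'I_N}, exists M : {set 'I_N},
      [&& chain_end e t l' X, M \subset X, #|M| == t, clique e M &
        [forall u in M, forall v in Y, (u < v) && e u v]]]
  else true.

Lemma chain_end_extend (N : nat) (e : rel 'I_N) (t l : nat)
    (X M Y : {set 'I_N}) :
  chain_end e t l X -> M \subset X -> #|M| = t -> clique e M ->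
  (forall u v, u \in M -> v \in Y -> (u < v) && e u v) ->
  chain_end e t l.+1 Y.
Proof.
move=> endX sMX cM clM MY /=; apply/existsP; exists X; apply/existsP; exists M.
rewrite endX sMX cM eqxx clM /=.
by apply/forall_inP => u uM; apply/forall_inP => v; apply: MY.
Qed.

(** Concatenate the cliques in order. As [M] lies in [X], induction supplies the edges into [M].
    Only the last [t] places must be adjacent to a further vertex [v], hence the guard
    [size s <= i + t]. *)
Lemma chain_end_path (N : nat) (e : rel 'I_N) (t l : nat) (Y : {set 'I_N}) :
  chain_end e t l Y ->
  exists s, [/\ size s = l * t, power_path e t s &
    forall (v x0 : 'I_N) i, v \in Y -> i < size s ->
      nth x0 s i < v /\ (size s <= i + t -> e (nth x0 s i) v)].
Proof.
elim: l Y => [|l IHl] Y /=; first by move=> _; exists [::].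
case/existsP => X /existsP[M /and5P[/IHl[s [szs pps sX]] sMX /eqP cM clM MY]].
have szM : size (enum M) = t by rewrite -cardE.
have MYP u v : u \in M -> v \in Y -> (u < v) && e u v.
  by move=> uM vY; have /forall_inP/(_ u uM)/forall_inP/(_ v vY) := MY.
exists (s ++ enum M); split; first by rewrite size_cat szs szM mulSn addnC.
  move=> x0 i j ltij; rewrite size_cat szM => ltj; rewrite !nth_cat.
  case: (ltnP j (size s)) => [ltjs|lejs].
    by rewrite (ltn_trans ltij ltjs); apply: pps.
  have ltj' : j - size s < size (enum M) by rewrite szM; lia.
  case: (ltnP i (size s)) => [ltis|leis].
    have jX : nth x0 (enum M) (j - size s) \in X.
      by rewrite (subsetP sMX) // -mem_enum mem_nth.
    have [lt eij] := sX _ x0 i jX ltis; split=> // leji; apply: eij.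
    exact: leq_trans lejs leji.
  have ltij' : i - size s < j - size s by lia.
  have [lt eij] := clique_power_path t clM x0 ltij' ltj'.
  by split=> // leji; apply: eij; lia.
move=> v x0 i vY; rewrite size_cat szM => lti; rewrite nth_cat.
case: (ltnP i (size s)) => [ltis|leis]; last first.
  have iM : nth x0 (enum M) (i - size s) \in M.
    by rewrite -mem_enum mem_nth // szM; lia.
  by have /andP[lt eiv] := MYP _ _ iM vY; split.
split; last by lia.
(* The inequality [nth x0 s i < v] passes through a vertex of [M]; if [t = 0] there is none, but
   then [s] is empty. *)
have [t0|t_gt0] := posnP t.
  by move: szs; rewrite t0 muln0 => sz0; rewrite sz0 in ltis.
have u0M : nth x0 (enum M) 0 \in M by rewrite -mem_enum mem_nth // szM.
have [lt1 _] := sX _ x0 i (subsetP sMX _ u0M) ltis.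
by apply: ltn_trans lt1 _; have /andP[] := MYP _ _ u0M vY.
Qed.

(** * Greedy construction of a blue power path *)

(** The pick in [D k] avoids vertices of high red degree into one of the next [t] sets and red
    neighbors of the last [t] picks. Each of these [2 * t] sets fills at most a fraction [1 / q] of
    [D k], and [2 * t < q]. *)
Lemma power_path_transversal (N : nat) (e : rel 'I_N) (t q n : nat)
    (D : nat -> {set 'I_N}) :
  2 * t < q ->
  (forall i, i < n -> 0 < #|D i|) ->
  (forall i j (u v : 'I_N), i < j -> j < n -> u \in D i -> v \in D j -> u < v) ->
  (forall i j, i < j -> j < n ->
     q * #|[set v in D i | #|D j| <= q * #|[set d in D j | e v d]|]| <= #|D i|) ->
  exists2 s, size s = n & power_path (fun u v => ~~ e u v) t s.
Proof.
move=> lt_tq D_gt0 ltD sparse.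
pose bad i j := [set v in D i | #|D j| <= q * #|[set d in D j | e v d]|].
suff: forall k, k <= n -> exists s, [/\ size s = k,
    forall (x0 : 'I_N) i, i < k -> nth x0 s i \in D i,
    power_path (fun u v => ~~ e u v) t s &
    forall (x0 : 'I_N) i j, i < k -> i < j -> j < n -> j <= i + t ->
      nth x0 s i \notin bad i j].
  by case/(_ n (leqnn n)) => s [szs _ pps _]; exists s.
elim=> [|k IHk] ltkn; first by exists [::].
have [s [szs sD pps sbad]] := IHk (ltnW ltkn).
have [x0 _] : exists x, x \in D k by apply/card_gt0P/D_gt0.
(* Index [o] stands for distance [o.+1]: [B1] looks forward, [B2] backward, and both are empty out
   of range. *)
pose B1 (o : 'I_t) := if k + o.+1 < n then bad k (k + o.+1) else set0.
pose B2 (o : 'I_t) :=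
  if o < k then [set d in D k | e (nth x0 s (k - o.+1)) d] else set0.
pose U := \bigcup_o (B1 o :|: B2 o).
have leB1 o : q * #|B1 o| <= #|D k|.
  rewrite /B1; case: ifP => [lt|_]; last by rewrite cards0 muln0.
  by apply: sparse => //; lia.
have leB2 o : q * #|B2 o| <= #|D k|.
  rewrite /B2; case: ifP => [lt|_]; last by rewrite cards0 muln0.
  have ltk : k - o.+1 < k by lia.
  have : nth x0 s (k - o.+1) \notin bad (k - o.+1) k.
    by apply: sbad => //; have := ltn_ord o; lia.
  by rewrite inE sD //= -ltnNge => /ltnW.
have leU : q * #|U| <= 2 * t * #|D k|.
  have : #|U| <= \sum_o (#|B1 o| + #|B2 o|).
    apply: (big_ind2 (fun (A : {set 'I_N}) m => #|A| <= m)) => [|A m A' m' leA leA'|o _].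
    - by rewrite cards0.
    - by apply: leq_trans (leq_card_setU _ _) _; apply: leq_add.
    - exact: leq_card_setU.
  rewrite -(leq_pmul2l (leq_ltn_trans (leq0n _) lt_tq)) => /leq_trans; apply.
  rewrite big_distrr /= mulnAC mulnC -[t in t * _]card_ord -sum_nat_const.
  by apply: leq_sum => o _; rewrite mulnDr mul2n -addnn leq_add.
have [v vD vU] : exists2 v, v \in D k & v \notin U.
  apply/subsetPn; apply/negP => /subset_leq_card.
  rewrite leqNgt => /negP; apply; rewrite -(ltn_pmul2l (_ : 0 < q)); last by lia.
  by apply: leq_ltn_trans leU _; rewrite ltn_pmul2r // D_gt0.
exists (rcons s v); split=> [|y0 i ltik|y0 i j ltij|y0 i j ltik ltij ltjn lejt].
- by rewrite size_rcons szs.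
- rewrite nth_rcons szs; case: (ltngtP i k) => [lt|gt|->] //; first exact: sD.
  by lia.
- rewrite size_rcons szs ltnS => lejk.
  have ltik : i < k by lia.
  rewrite !nth_rcons szs ltik; case: (ltngtP j k) => [lt|gt|defj].
  + by apply: pps; rewrite ?szs.
  + by lia.
  subst j; split; first by apply: (ltD i k) => //; apply: sD.
  move=> lekt; have lto : k - i.+1 < t by lia.
  apply: contra vU => eiv; apply/bigcupP; exists (Ordinal lto) => //.
  rewrite inE /B2 /= (_ : k - i.+1 < k); last by lia.
  rewrite (_ : k - (k - i.+1).+1 = i); last by lia.
  by rewrite [X in _ || X]inE vD (set_nth_default y0) ?szs // eiv orbT.
- rewrite nth_rcons szs; case: (ltngtP i k) => [lt|gt|defi]; first exact: sbad.
    by lia.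
  subst i; apply: contra vU => vbad; have lto : j - k.+1 < t by lia.
  apply/bigcupP; exists (Ordinal lto) => //.
  by rewrite inE /B1 /= (_ : k + (j - k.+1).+1 = j) ?ltjn ?vbad //; lia.
Qed.

(** * The dichotomy between red and blue power paths *)

Lemma card_interval (N a b : nat) :
  a + b <= N -> b <= #|[set v : 'I_N | a <= v < a + b]|.
Proof.
move=> leN; have lt (i : 'I_b) : a + i < N.
  by apply: leq_trans leN; rewrite ltn_add2l.
have inj : injective (fun i : 'I_b => Ordinal (lt i)).
  by move=> i j /(congr1 val) /= /addnI/val_inj.
rewrite -{1}[b]card_ord -(card_imset _ inj); apply: subset_leq_card.
by apply/subsetP => _ /imsetP[i _ ->]; rewrite inE /= leq_addr ltn_add2l ltn_ord.
Qed.

(** Origin of the constants: [q] exceeds [2 * t] for the greedy step; [a] is the size of [Y]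
    required by [common_neighborhood] with [r = n ^ t.-1], the Ramsey threshold for red [t]-cliques;
    [y = q * a] makes [a] a fraction [1 / q] of a [y]-set; [2 * q * a * y] is the size required of
    [D]; the outer parenthesis is the interval length for [exact_level]. *)
Lemma power_path_dichotomy (N : nat) (e : rel 'I_N) (t n : nat) :
  let q := 4 * t in let a := 2 * n ^ t.-1 * q ^ t in let y := q * a in
  symmetric e -> 0 < t -> 0 < n -> n * n * (y + n * (2 * q * a * y)) <= N ->
  (exists2 s, n <= size s & power_path e t s) \/
  (exists2 s, n <= size s & power_path (fun u v => ~~ e u v) t s).
Proof.
move=> q a y symE t_gt0 n_gt0.
set w := 2 * q * a * y; set b := y + n * w => leN.
have r_gt0 : 0 < n ^ t.-1 by rewrite expn_gt0 n_gt0.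
have q_gt0 : 0 < q by rewrite muln_gt0.
have a_gt0 : 0 < a by rewrite !muln_gt0 r_gt0 expn_gt0 q_gt0.
have y_gt0 : 0 < y by rewrite muln_gt0 q_gt0.
have w_gt0 : 0 < w by rewrite 3!muln_gt0 q_gt0 a_gt0 y_gt0.
case: (boolP [exists Y : {set 'I_N}, chain_end e t n Y]) => [|noend].
  case/existsP => Y /chain_end_path[s [szs pps _]]; left.
  by exists s => //; rewrite szs leq_pmulr.
case: (boolP [exists M : {set 'I_N},
    (#|M| == n) && clique (fun u v => ~~ e u v) M]) => [|nocl].
  case/existsP => M /andP[/eqP cM clM]; right; exists (enum M).
    by rewrite -cardE cM.
  exact: clique_power_path.
have Pn (Y : {set 'I_N}) : ~~ chain_end e t n Y.
  by move: noend; rewrite negb_exists => /forallP.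
have exM (S : {set 'I_N}) : n ^ t.-1 <= #|S| ->
    exists M : {set 'I_N}, [/\ M \subset S, #|M| = t & clique e M].
  case/(ramsey_clique symE n_gt0) => -[M [sM cM clM]].
    by exists M; rewrite sM cM prednK.
  by case/existsP: nocl; exists M; rewrite cM eqxx.
have level (j : 'I_(n * n)) : exists x : 'I_n * {set 'I_N},
    [/\ x.2 \subset [set v : 'I_N | j * b <= v < j * b + b], w <= #|x.2|,
    forall Y : {set 'I_N}, Y \subset x.2 -> #|Y| = y -> ~~ chain_end e t x.1.+1 Y &
    forall (Q : {set 'I_N}) (m : nat),
      (forall Y : {set 'I_N}, Y \subset x.2 -> #|Y| = y -> chain_end e t x.1 Y ->
         #|Y :&: Q| <= m) ->
      #|x.2 :&: Q| * y <= m * #|x.2|].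
  have leI : b <= #|[set v : 'I_N | j * b <= v < j * b + b]|.
    apply: card_interval; apply: leq_trans leN.
    by rewrite -mulSnr leq_mul2r ltn_ord orbT.
  have [//|l [D [ltln sD leD noD denseD]]] :=
    exact_level (P := chain_end e t) y_gt0 _ Pn leI.
  by exists (Ordinal ltln, D).
have [F FP] := fin_all_exists level.
(* There are [n] levels for [n * n] intervals, so some level [l] occurs at least [n] times. *)
have [||l] := @pigeonhole_fiber _ _ (fun j => (F j).1) n.
- by rewrite card_ord muln_gt0 n_gt0.
- by rewrite !card_ord.
set J := [set j | _] => leJ.
have j0 : 'I_(n * n) by apply: (@Ordinal _ 0); rewrite muln_gt0 n_gt0.
pose nj i := nth j0 (enum J) i.
pose D i := (F (nj i)).2.
have njJ i : i < n -> (F (nj i)).1 = l.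
  move=> ltin; have : nj i \in J.
    by rewrite -mem_enum mem_nth // -cardE (leq_trans ltin).
  by rewrite inE => /eqP.
have ltD i j (u v : 'I_N) : i < j -> j < n -> u \in D i -> v \in D j -> u < v.
  move=> ltij ltjn uD vD.
  have [/subsetP/(_ u uD) uI _ _ _] := FP (nj i).
  have [/subsetP/(_ v vD) vI _ _ _] := FP (nj j).
  have lt : nj i < nj j by apply: nth_enum_lt => //; apply: leq_trans leJ.
  move: uI vI; rewrite !inE => /andP[_ ltu] /andP[lev _].
  apply: leq_trans lev; apply: leq_trans ltu _.
  by rewrite -mulSnr leq_mul2r lt orbT.
right; have [||||s szs pps] := @power_path_transversal N e t q n D; last first.
- by exists s; rewrite ?szs.
- move=> i j ltij ltjn; have ltin := ltn_trans ltij ltjn.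
  set Q := [set v in D i | _].
  have [_ _ _ denseD] := FP (nj i); have [_ lew noD _] := FP (nj j).
  have : #|D i :&: Q| * y <= a * #|D i|.
    (* If [Y] had more than [a] vertices in [Q], it would contain a red [t]-clique with [y] common
       red neighbors in [D j], a [y]-set of level [l.+1] excluded there. *)
    apply: denseD => Y sY cY endY; rewrite leqNgt; apply/negP => /ltnW.
    case/subset_of_card => Y' sY' cY'.
    have [|v vY'|||M [sM cM clM leM]] :=
      @common_neighborhood _ e (clique e) Y' (D j) t q (n ^ t.-1) y t_gt0 q_gt0 r_gt0.
    + by move=> S _; apply: exM.
    + by have := subsetP sY' v vY'; rewrite !inE => /and3P[].
    + by rewrite cY'.
    + by rewrite cY'.
    have [Z sZ cZ] := subset_of_card leM.
    have sMY : M \subset Y.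
      by apply: subset_trans sM _; apply: subset_trans sY' (subsetIl _ _).
    have /negP : ~~ chain_end e t (F (nj j)).1.+1 Z; last case.
      apply: noD cZ; apply: subset_trans sZ _; apply/subsetP => v.
      by rewrite inE => /andP[].
    rewrite njJ // -(njJ i) //; apply: (chain_end_extend endY sMY cM clM) => u v uM.
    move/(subsetP sZ); rewrite inE => /andP[vD /forall_inP/(_ u uM)->].
    by rewrite andbT (ltD i j) // (subsetP sY) // (subsetP sMY).
  rewrite (setIidPr _); last by apply/subsetP => v; rewrite inE => /andP[].
  by rewrite /y mulnC -mulnA mulnCA leq_pmul2l.
- exact: ltD.
- by move=> i ltin; have [_ lew _ _] := FP (nj i); apply: leq_trans lew.
- by rewrite /q; lia.
Qed.

(** * The case [t = 1] *)

(** The vertices of [S] with no red edge from a smaller vertex of [S] form a blue clique [T]. If it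
    is small, a nonempty path found in [S :\: T] extends backward, as its first vertex has a smaller
    red neighbor in [S]. *)
Lemma dominance_path (N : nat) (e : rel 'I_N) (m k : nat) (S : {set 'I_N}) :
  symmetric e -> 0 < m -> k * m <= #|S| ->
  (exists s, [/\ size s = k, {subset s <= S} &
     sorted (fun u v : 'I_N => (u < v) && e u v) s]) \/
  (exists2 M : {set 'I_N}, m <= #|M| & clique (fun u v => ~~ e u v) M).
Proof.
move=> symE m_gt0; elim: k S => [|k IHk] S leS; first by left; exists [::].
pose T := [set v in S | [forall u in S, (u < v) ==> ~~ e u v]].
have sTS : T \subset S by apply/subsetP => v; rewrite inE => /andP[].
have [leT|ltT] := leqP m #|T|.
  right; exists T => //; apply/cliqueP => u v.
  rewrite !inE => /andP[uS /forall_inP uT] /andP[vS /forall_inP vT] uv.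
  case: (ltngtP u v) => [lt|gt|/val_inj eq]; last by rewrite eq eqxx in uv.
    by have /implyP := vT u uS; apply.
  by rewrite symE; have /implyP := uT v vS; apply.
case: (IHk (S :\: T)); last by right.
  by rewrite cardsD (setIidPr sTS); move: leS; rewrite mulSn; lia.
case=> -[|x s] [szs sS ps]; left.
  have /card_gt0P[v vS] : 0 < #|S| by apply: leq_trans leS; rewrite muln_gt0.
  exists [:: v]; rewrite -szs; split=> // z.
  by rewrite inE => /eqP->.
have : x \in S :\: T by apply: sS; rewrite mem_head.
rewrite !inE negb_and => /andP[/orP[/negbTE->//|/forall_inPn[u uS ux]] xS].
rewrite negb_imply negbK in ux.
exists (u :: x :: s); split=> /=; [by rewrite -szs| |by rewrite ux].
move=> z; rewrite inE => /orP[/eqP->//|/sS].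
by rewrite inE => /andP[].
Qed.

Lemma sorted_power_path (N : nat) (e : rel 'I_N) (s : seq 'I_N) :
  sorted (fun u v : 'I_N => (u < v) && e u v) s -> power_path e 1 s.
Proof.
move=> sorted_s x0 i j ltij ltj; split.
  have: sorted (fun u v : 'I_N => u < v) s.
    by apply: sub_sorted sorted_s => u v /andP[].
  rewrite sorted_pairwise; last by move=> ? ? ?; apply: ltn_trans.
  by move/pairwiseP => /(_ x0 i j); apply; rewrite ?inE // (ltn_trans ltij).
rewrite addn1 => leji; have defj : j = i.+1 by lia.
by subst j; have /(sortedP x0)/(_ i ltj)/andP[] := sorted_s.
Qed.

(** * Numerical estimate and conclusion *)

(** The left side is at most [192 * t ^ 2 * (16 * t ^ 2) ^ t * n ^ (2 * t + 1)]. The hypothesis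
    [1 < t] gives [t.+1 <= t ^ 2] and [2 * t + 1 <= 4 * t - 2]. *)
Lemma dichotomy_bound (t n : nat) (q := 4 * t) (a := 2 * n ^ t.-1 * q ^ t) :
  1 < t -> 0 < n ->
  n * n * (q * a + n * (2 * q * a * (q * a)))
    <= (400 * t ^ 3) ^ (t ^ 2) * n ^ (4 * t - 2).
Proof.
move=> t_gt1 n_gt0; have q_gt0 : 0 < q by rewrite /q; lia.
have a_gt0 : 0 < a by rewrite !muln_gt0 !expn_gt0 n_gt0 q_gt0.
have qa_gt0 : 0 < q * a by rewrite muln_gt0 q_gt0.
(* The [3] is [2] plus one for the lower-order term, as [q * a <= n * (q * a) ^ 2]. *)
apply: (@leq_trans (n * n * (n * (3 * (q * a) ^ 2)))).
  rewrite leq_mul2l; apply/orP; right.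
  have : q * a <= n * (q * a) ^ 2 by rewrite -mulnn mulnA leq_pmull // muln_gt0 n_gt0.
  rewrite -[2 * q * a]mulnA -mulnA mulnn [n * (2 * _)]mulnCA [n * (3 * _)]mulnCA.
  by move: (q * a) (n * _) => u v; lia.
have -> : n * n * (n * (3 * (q * a) ^ 2)) =
    (192 * t ^ 2 * (16 * t ^ 2) ^ t) * n ^ (2 * t + 1).
  have -> : n ^ (2 * t + 1) = n * n * n * n ^ (t.-1 * 2).
    by rewrite (_ : 2 * t + 1 = (t.-1 * 2).+3) ?expnS ?mulnA //; lia.
  have qE : q ^ 2 = 16 * t ^ 2 by rewrite /q expnMn.
  have -> : (16 * t ^ 2) ^ t = (q ^ t) ^ 2 by rewrite -qE -!expnM mulnC.
  have -> : (q * a) ^ 2 = 16 * t ^ 2 * (4 * n ^ (t.-1 * 2) * (q ^ t) ^ 2).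
    by rewrite expnMn qE /a !expnMn -[(n ^ _) ^ 2]expnM.
  by move: (n ^ (t.-1 * 2)) (t ^ 2) ((q ^ t) ^ 2) => u v z; lia.
apply: leq_mul; last by rewrite leq_pexp2l //; lia.
apply: (@leq_trans ((400 * t ^ 3) ^ t.+1)).
  rewrite [X in _ <= X]expnS leq_mul //.
    by apply: leq_mul => //; rewrite leq_pexp2l //; lia.
  rewrite leq_exp2r; last by lia.
  by apply: leq_mul => //; rewrite leq_pexp2l //; lia.
rewrite leq_pexp2l //; last by rewrite -mulnn; nia.
by rewrite muln_gt0 expn_gt0; lia.
Qed.

Theorem theorem1p3 (t n : nat) (ht : 0 < t) (hn : 0 < n) :
  ordered_ramsey (path_power n t) (path_power n t)
    <= (400 * t ^ 3) ^ (t ^ 2) * n ^ (4 * t - 2).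
Proof.
have upper N : (forall e : rel 'I_N, symmetric e ->
    (exists2 s, n <= size s & power_path e t s) \/
    (exists2 s, n <= size s & power_path (fun u v => ~~ e u v) t s)) ->
    ordered_ramsey (path_power n t) (path_power n t) <= N.
  move=> dich; rewrite /ordered_ramsey; case: ex_minnP => m _; apply.
  apply/forallP => c; apply/orP.
  case: (dich (fun u v => c [set u; v])) => [u v|[s les pps]|[s les pps]].
  - by rewrite setUC.
  - left; apply: power_path_copy les _ => x0 i j ltij ltj.
    by have [lt eij] := pps x0 i j ltij ltj; split=> // /eij->.
  - right; apply: power_path_copy les _ => x0 i j ltij ltj.
    by have [lt eij] := pps x0 i j ltij ltj; split=> // /eij/negbTE->.
(* For [t = 1] the exponent [2 * t + 1 = 3] exceeds [4 * t - 2 = 2], so the dominance argument with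
   [N = n * n] takes over. *)
have [t_gt1|let1] := ltnP 1 t.
  apply: leq_trans (upper _ _) (dichotomy_bound t_gt1 hn) => e symE.
  exact: power_path_dichotomy.
have -> : t = 1 by lia.
move: upper; have -> : t = 1 by lia.
move=> upper; apply: leq_trans (upper (n * n) _) _ => [e symE|].
  have [|[s [szs _ ps]]|[M leM clM]] := @dominance_path _ e n n setT symE hn.
  - by rewrite cardsT card_ord.
  - by left; exists s; rewrite ?szs //; apply: sorted_power_path.
  - right; exists (enum M); first by rewrite -cardE.
    exact: clique_power_path.
by rewrite mulnn leq_pmull.
Qed.
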